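(* Let $Q\in\mathbb R^{n_{\mathrm f}\times n_{\mathrm f}}$ be symmetric positive definite, $A_{\mathrm f}\in\mathbb R^{m\times n_{\mathrm f}}$, $w_{\mathrm f}\in\mathbb R^{n_{\mathrm f}}$, $b\in\mathbb R^m$ and $\lambda\in\mathbb R^m$. Let $$\mathcal L_{\mathrm f}(\xi_{\mathrm f},\lambda)=\tfrac12\xi_{\mathrm f}^\top Q\,\xi_{\mathrm f}+w_{\mathrm f}^\top\xi_{\mathrm f}-\lambda^\top(A_{\mathrm f}\xi_{\mathrm f}-b).$$ Then the minimizer $\mathcal S_{\xi_{\mathrm f}}(\lambda)=\operatorname{arg\,min}_{\xi_{\mathrm f}\in\mathbb R^{n_{\mathrm f}}}\mathcal L_{\mathrm f}(\xi_{\mathrm f},\lambda)$ is given by $$\mathcal S_{\xi_{\mathrm f}}(\lambda)=Q^{-1}(A_{\mathrm f}^\top\lambda-w_{\mathrm f}).$$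
   Context: $m,n_{\mathrm f}\ge1$ are integers. No further definitions are needed. *)

(* Defs.v *)
From mathcomp Require Import all_boot all_order all_algebra.
From mathcomp Require Import boolp classical_sets reals.

Set Implicit Arguments.
Unset Strict Implicit.
Unset Printing Implicit Defensive.

Import Order.TTheory GRing.Theory Num.Theory.

Local Open Scope classical_set_scope.
Local Open Scope ring_scope.

Definition spd_mx (R : realType) (n : nat) (Q : 'M[R]_n) : Prop :=
  Q \is symmetricmx /\
  forall v : 'cV[R]_n, v != 0 -> 0 < (v^T *m Q *m v) 0 0.

(* The set of all global minimizers: it is empty when the minimum is not
   attained, and a singleton exactly when the minimizer exists and is unique. *)
Definition argmin (R : realType) (T : Type) (f : T -> R) : set T :=
  [set x | forall y, f x <= f y].

(* The products are 1 x 1 matrices, hence the [0 0] entries. *)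
Definition lagrangian (R : realType) (m n : nat) (Q : 'M[R]_n)
    (A : 'M[R]_(m, n)) (w : 'cV[R]_n) (b : 'cV[R]_m)
    (xi : 'cV[R]_n) (lambda : 'cV[R]_m) : R :=
  2^-1 * (xi^T *m Q *m xi) 0 0 + (w^T *m xi) 0 0
  - (lambda^T *m (A *m xi - b)) 0 0.

(* Main.v *)
Require Import Defs.
From mathcomp Require Import all_boot all_order all_algebra.
From mathcomp Require Import boolp classical_sets reals.
From mathcomp Require Import ring.

(** The Lagrangian is a quadratic polynomial in [xi] with Hessian [Q] and
    gradient [Q xi + w - A^T lambda].  A stationary point [x] therefore
    completes the square: the increment from [x] to [x + d] has no linear
    term and equals half the energy [d^T Q d], which is positive unless [d]
    vanishes ([lagrangian_stationaryD]).  So a stationary point is the one and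
    only global minimizer.  Since a positive definite matrix has trivial
    kernel ([spd_mx_unit]), the stationarity equation
    [Q x = A^T lambda - w] has the solution [Q^-1 (A^T lambda - w)]. *)

Set Implicit Arguments.
Unset Strict Implicit.
Unset Printing Implicit Defensive.

Import Order.TTheory GRing.Theory Num.Theory.

Local Open Scope classical_set_scope.
Local Open Scope ring_scope.

Lemma symmetricmx_tr (R : fieldType) (n : nat) (Q : 'M[R]_n) :
  Q \is symmetricmx -> Q^T = Q.
Proof.
move/is_hermitianmxP=> {2}->; rewrite expr0 scale1r.
by apply/matrixP=> i j; rewrite !mxE.
Qed.

(** A nonzero row vector in the left kernel of [Q] would have zero energy. *)
Lemma spd_mx_unit (R : realType) (n : nat) (Q : 'M[R]_n) :
  spd_mx Q -> Q \in unitmx.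
Proof.
case=> _ Qpos; rewrite -row_free_unit; apply: inj_row_free => v vQ0.
apply/eqP; apply: contraT => v0.
have /Qpos : v^T != 0 by rewrite trmx_eq0.
by rewrite trmxK vQ0 mul0mx mxE ltxx.
Qed.

(** At a stationary point the two cross terms of the energy coincide, by
    symmetry of [Q], and together cancel the linear part. *)
Lemma lagrangian_stationaryD (R : realType) (m n : nat) (Q : 'M[R]_n)
    (A : 'M[R]_(m, n)) (w : 'cV[R]_n) (b lambda : 'cV[R]_m) (x d : 'cV[R]_n) :
  Q \is symmetricmx -> Q *m x = A^T *m lambda - w ->
  lagrangian Q A w b (x + d) lambda =
  lagrangian Q A w b x lambda + 2^-1 * (d^T *m Q *m d) 0 0.
Proof.
move=> /symmetricmx_tr Qsym Qx.
have xQd : x^T *m Q *m d = lambda^T *m (A *m d) - w^T *m d.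
  rewrite -{1}Qsym -trmx_mul Qx linearB /= trmx_mul trmxK mulmxBl.
  by rewrite mulmxA.
have dQx : d^T *m Q *m x = (x^T *m Q *m d)^T.
  by rewrite !trmx_mul trmxK Qsym mulmxA.
rewrite /lagrangian [(x + d)^T]linearD /= !(mulmxDl, mulmxDr, mulmxBr) dQx xQd.
(* The 1 x 1 products must be opaque before taking entries, lest they unfold
   into sums. *)
move: (x^T *m Q *m x) (d^T *m Q *m d) (w^T *m x) (w^T *m d) => xx dd wx wd.
move: (lambda^T *m (A *m x)) (lambda^T *m (A *m d)) => lx ld.
rewrite mulmxN.
move: (lambda^T *m b) => lb; rewrite !mxE.
by field.
Qed.

(* [invmx] is the identity on singular matrices, so the invertibility of Q,
   implicit in writing its inverse, is part of the conclusion. *)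
Theorem lemma3p1 (R : realType) (m n : nat) (hm : (0 < m)%N) (hn : (0 < n)%N)
    (Q : 'M[R]_n) (hQ : spd_mx Q) (A : 'M[R]_(m, n)) (w : 'cV[R]_n)
    (b : 'cV[R]_m) (lambda : 'cV[R]_m) :
  Q \in unitmx /\
  argmin (fun xi : 'cV[R]_n => lagrangian Q A w b xi lambda) =
    [set invmx Q *m (A^T *m lambda - w)].
Proof.
have [Qsym Qpos] := hQ; have Qunit := spd_mx_unit hQ; split=> //.
set x := invmx Q *m _.
have Qx : Q *m x = A^T *m lambda - w by rewrite mulKVmx.
have minE y : lagrangian Q A w b y lambda = lagrangian Q A w b x lambda
    + 2^-1 * ((y - x)^T *m Q *m (y - x)) 0 0.
  by rewrite -(lagrangian_stationaryD _ _ Qsym Qx) addrC subrK.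
apply/seteqP; split=> [y ymin | _ -> y] /=.
- apply/eqP; rewrite -subr_eq0; apply: contraT => /Qpos yx_gt0.
  have := ymin x.
  by rewrite (minE y) gerDl leNgt mulr_gt0 ?invr_gt0 ?ltr0n.
- rewrite (minE y) lerDl; have [-> | /Qpos yx_gt0] := eqVneq (y - x) 0.
    by rewrite mulmx0 mxE mulr0.
  by rewrite mulr_ge0 ?invr_ge0 ?ler0n ?ltW.
Qed.
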